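(* Let $t \ge 1$ be an integer. 1) A $(2t+1)$-regular graph $G$ has a $t$-factor if and only if $2+\frac{1}{t} \in {\cal S}(G)$. 2) If $G$ is a $(2t+1)$-regular graph and has a $1$-factor, then $3 \in \overline{{\cal S}}(G)$. Furthermore, for each integer $t > 1$ there is a $(2t+1)$-regular graph $G_t$ which has no $1$-factor and satisfies $3 \in \overline{{\cal S}}(G_t)$.
   Context: Graphs are finite and may have parallel edges but no loops. A $k$-factor of a graph is a spanning $k$-regular subgraph. A signed graph $(G,\sigma)$ is a graph $G$ with a function (signature) $\sigma: E(G)\to\{\pm1\}$. Each edge $e=uv$ is divided into two half-edges $h_e^u$ (incident with $u$) and $h_e^v$ (incident with $v$); $H(G)$ is the set of half-edges, $H(v)$ the set of half-edges incident with $v$, and $e_h$ the edge containing the half-edge $h$. An orientation of $(G,\sigma)$ is a function $\tau: H(G)\to\{\pm1\}$ with $\tau(h_e^u)\tau(h_e^v) = -\sigma(e)$ for each edge $e=uv$. Given an orientation $\tau$, the boundary of $f:E(G)\to\mathbb{R}$ is $\delta f(v)=\sum_{h\in H(v)}\tau(h)f(e_h)$. For real $r\ge 2$, $f$ is an $r$-flow on $(G,\sigma)$ if, for every edge $e$, $f(e)=0$ or $1\le |f(e)|\le r-1$, and $\delta f(v)=0$ for all $v\in V(G)$; it is nowhere-zero if $f(e)\ne 0$ for all $e$. $(G,\sigma)$ admits a nowhere-zero $r$-flow if one exists for some orientation, and $(G,\sigma)$ is flow-admissible if it admits a nowhere-zero $r$-flow for some $r\ge2$. $F_c((G,\sigma))=\inf\{r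 : (G,\sigma)\text{ admits a nowhere-zero }r\text{-flow}\}$, and $F((G,\sigma))$ is the smallest integer $k$ such that $(G,\sigma)$ admits an integer-valued nowhere-zero $k$-flow (both are $\infty$ if $(G,\sigma)$ is not flow-admissible). The flow spectrum ${\cal S}(G)$ is the set of all $F_c((G,\sigma))$, and the integer flow spectrum $\overline{{\cal S}}(G)$ the set of all $F((G,\sigma))$, where $\sigma$ ranges over all signatures of $G$ for which $(G,\sigma)$ is flow-admissible. *)

(* Defs.v *)
From mathcomp Require Import all_boot all_order all_algebra.
From mathcomp Require Import boolp classical_sets reals constructive_ereal ereal.

Set Implicit Arguments.
Unset Strict Implicit.
Unset Printing Implicit Defensive.

Import Order.TTheory GRing.Theory Num.Theory.

Local Open Scope ring_scope.

(* Parallel edges are allowed ([ends] need not be injective), loops are not.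
   The vertex set is nonempty: the empty graph is regular of every degree and
   has a k-factor for every k, but both its spectra are {2}. *)
Record multigraph := Multigraph {
  vertex : finType;
  edge : finType;
  ends : edge -> {set vertex};
  card_ends : forall e, #|ends e| = 2%N;
  card_vertex_gt0 : (0 < #|vertex|)%N
}.

(* A spanning subgraph is given by its set of edges. *)
Definition degree_in (G : multigraph) (F : {set edge G}) (v : vertex G) : nat :=
  #|[set e in F | v \in ends e]|.

Definition is_factor (G : multigraph) (k : nat) (F : {set edge G}) : Prop :=
  forall v : vertex G, degree_in F v = k.

Definition has_factor (G : multigraph) (k : nat) : Prop :=
  exists F : {set edge G}, is_factor k F.

Definition regular (G : multigraph) (k : nat) : Prop :=
  forall v : vertex G, degree_in [set: edge G] v = k.

(* As there are no loops, the half-edge of [e] at [v] is the pair [(e, v)]. *)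
Definition half_edge (G : multigraph) : finType :=
  {h : edge G * vertex G | h.2 \in ends h.1}.

Definition half_edge_edge (G : multigraph) (h : half_edge G) : edge G :=
  (val h).1.

Definition half_edge_vertex (G : multigraph) (h : half_edge G) : vertex G :=
  (val h).2.

(* The values +1 and -1 are encoded by the booleans false and true; the
   boolean [b] stands for [(-1) ^+ b]. *)
Definition signature (G : multigraph) := edge G -> bool.

Definition is_orientation (G : multigraph) (sigma : signature G)
    (tau : half_edge G -> bool) : Prop :=
  forall h h' : half_edge G,
    half_edge_edge h = half_edge_edge h' ->
    half_edge_vertex h != half_edge_vertex h' ->
    (-1) ^+ tau h * (-1) ^+ tau h' = - (-1) ^+ sigma (half_edge_edge h) :> int.

Section Flows.
Variables (R : realType) (G : multigraph).
Implicit Types (sigma : signature G) (tau : half_edge G -> bool).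
Implicit Types (f : edge G -> R) (r : R) (k : nat).

Definition boundary tau f (v : vertex G) : R :=
  \sum_(h : half_edge G | half_edge_vertex h == v)
    (-1) ^+ tau h * f (half_edge_edge h).

Definition is_flow tau r f : Prop :=
  (forall e, f e = 0 \/ 1 <= `|f e| <= r - 1) /\
  (forall v, boundary tau f v = 0).

Definition nowhere_zero f : Prop := forall e, f e != 0.

Definition admits_nz_flow sigma r : Prop :=
  2 <= r /\
  exists tau f, [/\ is_orientation sigma tau, is_flow tau r f & nowhere_zero f].

Definition admits_int_nz_flow sigma k : Prop :=
  (2 <= k)%N /\
  exists tau f, [/\ is_orientation sigma tau, is_flow tau k%:R f,
    nowhere_zero f & forall e, f e \is a Num.int].

Definition flow_admissible sigma : Prop := exists r, admits_nz_flow sigma r.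

Definition circular_flow_number sigma : \bar R :=
  ereal_inf [set r%:E | r in [set r | admits_nz_flow sigma r]]%classic.

(* [None] stands for infinity. *)
Definition integer_flow_number sigma : option nat :=
  if pselect (exists k, `[< admits_int_nz_flow sigma k >]) is left ex
  then Some (ex_minn ex) else None.

Definition flow_spectrum : set (\bar R) :=
  [set circular_flow_number sigma | sigma in
    [set sigma | flow_admissible sigma]]%classic.

Definition integer_flow_spectrum : set (option nat) :=
  [set integer_flow_number sigma | sigma in
    [set sigma | flow_admissible sigma]]%classic.

End Flows.

Arguments flow_spectrum : clear implicits.
Arguments integer_flow_spectrum : clear implicits.

(* Main.v *)
Require Import Defs.
From mathcomp Require Import all_boot all_order all_algebra.
From mathcomp Require Import boolp classical_sets reals constructive_ereal ereal.
From mathcomp Require Import fintype finset zify ring lra.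

Set Implicit Arguments.
Unset Strict Implicit.
Unset Printing Implicit Defensive.

Import Order.TTheory GRing.Theory Num.Theory.

Local Open Scope ring_scope.

(** Two observations about a vertex v of odd degree 2t+1 drive the proof.

    First, the signed values of a nowhere-zero flow on the half-edges at v split
    into positive and negative ones, with equal sums of absolute values; one
    side, the minority, has at most t members and the other at least t+1.  If
    all absolute values lie in [1, x], comparing the sums gives t+1 <= t x ([odd_balanced_bound]), so no
    signature has circular flow number below 2 + 1/t, and no odd regular graph
    has a nowhere-zero 2-flow.  The comparison is rigid: as soon as
    x < (2t+1)/(2t-1), which is slightly more than 1 + 1/t, the minority has
    exactly t members, all its absolute values are at least 2t/(2t-1), and all
    others are smaller ([card_heavy]).  Whether an edge is in the minority is
    then decided by its absolute value alone, hence equally at both of its ends, so the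
    heavy edges form a t-factor ([flow_spectrum_factor]).  As a whole interval
    of flow numbers above 2 + 1/t is covered, the infimum that defines the
    circular flow number need not be attained.  Conversely, given a t-factor,
    send 1 + 1/t outwards along its edges and 1 inwards along the other edges,
    at both ends: this is a flow on the all-negative signature
    ([factor_nz_flow]).

    Secondly, the signs of half-edges can be prescribed arbitrarily, because
    some signature always fits them ([signature_ofP]).  So a nowhere-zero integer
    3-flow for some signature is just a choice of a value 1 or 2 on each edge such that at
    each vertex the values cancel for some choice of signs.  With 2t+1 values
    this is possible when the number of ones is even and positive
    ([ones_and_twos_cancel]).  Hence 3 is in the integer flow spectrum whenever
    G has a subgraph D with positive even degrees
    ([even_subgraph_int_spectrum]).  The complement of a 1-factor is such a D.
    For the last claim, three triangles attached to a common centre by odd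
    numbers of edges have no 1-factor, since a 1-factor would use an edge from
    each triangle to the centre; for t > 1 there is enough room for a double
    edge at the centre, which together with the triangles gives D
    ([windmill_int_spectrum]). *)

(** * Choosing signs *)

Lemma sum_signs (R : pzRingType) (I : finType) (A : {set I}) (k : nat) :
  (k <= #|A|)%N ->
  exists s : I -> bool, \sum_(i in A) (-1) ^+ s i = #|A|%:R - k%:R *+ 2 :> R.
Proof.
move=> le_kA; pose S := [set i in take k (enum A)].
have SsubA : S \subset A.
  by apply/subsetP => i; rewrite inE => /mem_take; rewrite mem_enum.
have cardS : #|S| = k.
  rewrite cardsE (card_uniqP _) ?take_uniq ?enum_uniq //.
  by rewrite size_take_min -cardE; apply/minn_idPl.
exists (mem S); rewrite (big_setID S) /= (setIidPr SsubA).
rewrite (eq_bigr (fun=> -1)) => [|i /= ->]; last by rewrite expr1.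
rewrite [X in _ + X](eq_bigr (fun=> 1)) => [|i]; last first.
  by rewrite inE => /andP[/negPf /= ->]; rewrite expr0.
rewrite !sumr_const cardS cardsD (setIidPr SsubA) cardS natrB // mulNrn.
by rewrite mulr2n opprD addrCA.
Qed.

(** With an odd number of twos, alternating signs leave one 2 over.  A positive
    even number of ones can be signed to sum to -2 and absorb it. *)
Lemma ones_and_twos_cancel (R : comNzRingType) (I : finType) (H B : {set I}) :
  odd #|H :\: B| -> ~~ odd #|H :&: B| -> (0 < #|H :&: B|)%N ->
  exists s : I -> bool,
    \sum_(i in H) (-1) ^+ s i * (if i \in B then 1 else 2) = 0 :> R.
Proof.
move=> oddA evenB B_gt0.
have [p cardA] : exists p, #|H :\: B| = (p + p).+1.
  by exists #|H :\: B|./2; lia.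
have [q cardB] : exists q, #|H :&: B| = (q + q).+2.
  by exists #|H :&: B|./2.-1; lia.
have [|s sB] := @sum_signs R _ (H :&: B) q.+2; first by rewrite cardB; lia.
have [|s' sA] := @sum_signs R _ (H :\: B) p; first by rewrite cardA; lia.
exists (fun i => if i \in B then s i else s' i); rewrite (big_setID B) /=.
rewrite (eq_bigr (fun i => (-1) ^+ s i)) => [|i /setIP[_ ->]]; last first.
  by rewrite mulr1.
rewrite [X in _ + X](eq_bigr (fun i => (-1) ^+ s' i * 2)) => [|i]; last first.
  by rewrite inE => /andP[/negPf ->].
rewrite -mulr_suml sA sB cardA cardB; ring.
Qed.

(** * Zero-sum families of odd size *)

Section BalancedSums.
Variables (R : realFieldType) (I : finType) (H : {set I}) (g : I -> R) (t : nat).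
Variable x : R.
Hypothesis cardH : #|H| = (2 * t + 1)%N.
Hypothesis g_bounds : forall i, i \in H -> 1 <= `|g i| <= x.
Hypothesis sum_g : \sum_(i in H) g i = 0.

Lemma sum_norm_ge (A : {set I}) : A \subset H -> #|A|%:R <= \sum_(i in A) `|g i|.
Proof.
move=> /subsetP sAH; rewrite -sumr_const; apply: ler_sum => i /sAH.
by case/g_bounds/andP.
Qed.

Lemma sum_norm_le (A : {set I}) :
  A \subset H -> \sum_(i in A) `|g i| <= #|A|%:R * x.
Proof.
move=> /subsetP sAH; rewrite mulr_natl -sumr_const; apply: ler_sum => i /sAH.
by case/g_bounds/andP.
Qed.

(** The minority is either the set of positive terms or its complement; both
    carry the same total absolute value because the whole sum vanishes. *)
Lemma balanced_minority :
  exists P : {set I}, [/\ P \subset H, (#|P| <= t)%N &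
    \sum_(i in P) `|g i| = \sum_(i in H :\: P) `|g i|].
Proof.
pose Q := [set i in H | 0 < g i].
have sQH : Q \subset H by apply/subsetP => i; rewrite inE => /andP[].
have eqQ : \sum_(i in Q) `|g i| = \sum_(i in H :\: Q) `|g i|.
  apply/eqP; rewrite -subr_eq0 -sumrN; apply/eqP; rewrite -[RHS]sum_g.
  rewrite [RHS](big_setID Q) /= (setIidPr sQH); congr (_ + _).
    by apply: eq_bigr => i; rewrite inE => /andP[_ /gtr0_norm].
  apply: eq_bigr => i; rewrite !inE => /andP[]; case: (i \in H) => //=.
  rewrite -leNgt => g_le0 _.
  by rewrite ler0_norm // opprK.
case: (leqP #|Q| t) => leQt; first by exists Q.
exists (H :\: Q); rewrite subsetDl; split=> //.
  by rewrite cardsD (setIidPr sQH) cardH; lia.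
by rewrite setDDr setDv set0U (setIidPr sQH).
Qed.

(** The majority has at least t+1 members of size at least 1, the minority at
    most t members of size at most x. *)
Lemma odd_balanced_bound : t%:R + 1 <= t%:R * x.
Proof.
have [P [sPH cardP eqPN]] := balanced_minority.
have := sum_norm_le sPH; rewrite eqPN => le_x.
have ge_1 := sum_norm_ge (subsetDl H P).
rewrite cardsD (setIidPr sPH) cardH natrB ?natrD ?natrM in ge_1; last by lia.
have ubP : #|P|%:R <= t%:R :> R by rewrite ler_nat.
have x_ge1 : 1 <= x.
  have /set0Pn[i /g_bounds/andP[ge1 /(le_trans ge1)//]] : H != set0.
  by rewrite -card_gt0 cardH addn1.
nra.
Qed.

(** The threshold 2t/(2t-1) separates minority from majority.  A minority term is
    at least t+1 - (t-1)x, what the other minority terms cannot supply, and a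
    majority term is at most tx - t, what the other majority terms leave over.
    For x = (2t+1)/(2t-1) both bounds are equal to the threshold, which is why
    this is the range of x considered. *)
Lemma card_heavy : (1 <= t)%N -> (2 * t%:R - 1) * x < 2 * t%:R + 1 ->
  #|[set i in H | 2 * t%:R <= (2 * t%:R - 1) * `|g i|]| = t.
Proof.
move=> t_ge1 x_lt; have [P [sPH cardP eqPN]] := balanced_minority.
have ubP := sum_norm_le sPH; have lbN := sum_norm_ge (subsetDl H P).
have T_ge1 : 1 <= t%:R :> R by rewrite ler1n.
have cardN : #|H :\: P|%:R = 2 * t%:R + 1 - #|P|%:R :> R.
  rewrite cardsD (setIidPr sPH) cardH natrB; last by lia.
  by rewrite natrD natrM.
have cardPt : #|P| = t.
  apply/eqP; rewrite eqn_leq cardP /= leqNgt; apply/negP => ltPt.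
  have {}ltPt : #|P|%:R + 1 <= t%:R :> R by rewrite natr1 ler_nat.
  have : 0 <= #|P|%:R :> R by [].
  (* At most t-1 terms of size at most x cannot balance t+2 terms of size
     at least 1. *)
  rewrite cardN -eqPN in lbN.
  nra.
rewrite -[RHS]cardPt; congr #|pred_of_set _|; apply/setP => i; rewrite inE.
case: (boolP (i \in P)) => [iP|iNP].
  rewrite (subsetP sPH) //=.
  have := sum_norm_le (subset_trans (subD1set P i) sPH).
  have := lbN; rewrite cardN -eqPN (big_setD1 i iP) /=.
  have -> : #|P :\ i|%:R = t%:R - 1 :> R.
    by rewrite -cardPt (cardsD1 i P) iP natrD addrAC subrr add0r.
  rewrite cardPt; nra.
case: (boolP (i \in H)) => //= iH; apply/negbTE; rewrite -ltNge.
have iN : i \in H :\: P by rewrite inE iNP iH.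
have := sum_norm_ge (subset_trans (subD1set (H :\: P) i) (subsetDl H P)).
have := ubP; rewrite eqPN (big_setD1 i iN) /=.
have -> : #|(H :\: P) :\ i|%:R = t%:R :> R.
  have := cardN; rewrite (cardsD1 i (H :\: P)) iN add1n -natr1 cardPt.
  by move=> eqD; lra.
rewrite cardPt; nra.
Qed.

End BalancedSums.

(** * Half-edges and orientations *)

Section HalfEdges.
Variable G : multigraph.

Lemma half_edge_eq (h h' : half_edge G) :
  half_edge_edge h = half_edge_edge h' ->
  half_edge_vertex h = half_edge_vertex h' -> h = h'.
Proof.
move=> eqe eqv; apply: val_inj.
by rewrite [LHS]surjective_pairing [RHS]surjective_pairing; congr (_, _).
Qed.

Lemma card_half_edges_at (F : {set edge G}) (v : vertex G) :
  #|[set h : half_edge G |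
      (half_edge_vertex h == v) && (half_edge_edge h \in F)]| = degree_in F v.
Proof.
rewrite /degree_in -(card_in_imset (f := @half_edge_edge G)); last first.
  move=> h h'; rewrite !inE => /andP[/eqP hv _] /andP[/eqP h'v _] eqe.
  by apply: half_edge_eq; rewrite // hv h'v.
congr #|pred_of_set _|; apply/setP => e; rewrite inE.
apply/imsetP/andP => [[h] | [eF ve]].
  by rewrite inE => /andP[/eqP <- hF] ->; split=> //; apply: (valP h).
have he : (e, v).2 \in ends (e, v).1 by [].
by exists (Sub (e, v) he : half_edge G);
  rewrite ?inE /half_edge_vertex /half_edge_edge SubK ?eqxx.
Qed.

(** An edge must be negative exactly when its two half-edges have equal signs. *)
Definition signature_of (tau : half_edge G -> bool) : signature G :=
  fun e => [forall h, forall h',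
    (half_edge_edge h == e) && (half_edge_edge h' == e) ==> (tau h == tau h')].

(** This is what frees the construction of flows from the signature: signs may be
    chosen at each vertex on its own. *)
Lemma signature_ofP (tau : half_edge G -> bool) :
  is_orientation (signature_of tau) tau.
Proof.
move=> h h' eqe neqv.
suff -> : signature_of tau (half_edge_edge h) = (tau h == tau h').
  by case: (tau h) (tau h') => [] [].
apply/forallP/eqP => [/(_ h)/forallP/(_ h')|eqt h1].
  by rewrite eqe eqxx => /eqP.
suff taue k : half_edge_edge k = half_edge_edge h -> tau k = tau h.
  apply/forallP => h2; apply/implyP => /andP[/eqP e1 /eqP e2].
  by rewrite !taue.
move=> eqk.
have [kv|kNv] := eqVneq (half_edge_vertex k) (half_edge_vertex h).
  by congr tau; apply: half_edge_eq.
have [kv'|kNv'] := eqVneq (half_edge_vertex k) (half_edge_vertex h').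
  by rewrite eqt; congr tau; apply: half_edge_eq; rewrite // eqk.
(* A third half-edge [k] would give the edge three ends. *)
have : (#|[set half_edge_vertex h; half_edge_vertex h'; half_edge_vertex k]|
         <= #|ends (half_edge_edge h)|)%N.
  apply/subset_leq_card/subsetP => v.
  rewrite !inE => /orP[/orP[]|] /eqP ->.
  - exact: (valP h).
  - by rewrite eqe; apply: (valP h').
  - by rewrite -eqk; apply: (valP k).
by rewrite card_ends setUC cardsU1 cards2 !inE (negPf kNv) (negPf kNv') neqv.
Qed.

End HalfEdges.

(** * Flows at a vertex of odd degree *)

Section HalfEdgeSums.
Variables (R : realType) (G : multigraph).

Lemma sum_half_edges_const (F : {set edge G}) (v : vertex G) (c : R) :
  \sum_(h : half_edge G |
      (half_edge_vertex h == v) && (half_edge_edge h \in F)) c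
    = (degree_in F v)%:R * c.
Proof.
rewrite -card_half_edges_at mulr_natl -sumr_const.
by apply: eq_bigl => h; rewrite inE.
Qed.

Lemma degree_in_setC (D : {set edge G}) (v : vertex G) :
  (degree_in D v + degree_in (~: D) v)%N = degree_in [set: edge G] v.
Proof.
rewrite /degree_in -(cardsID D [set e in [set: edge G] | v \in ends e]).
by congr (_ + _)%N; congr #|pred_of_set _|; apply/setP => e;
  rewrite !inE // andbC.
Qed.

Section AtVertex.
Variables (t : nat) (tau : half_edge G -> bool) (r : R) (f : edge G -> R).
Hypotheses (regG : regular G (2 * t + 1)) (flow_f : is_flow tau r f).
Hypothesis nz_f : nowhere_zero f.
Variable v : vertex G.

Let H := [set h : half_edge G | half_edge_vertex h == v].
Let g (h : half_edge G) : R := (-1) ^+ tau h * f (half_edge_edge h).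

Lemma norm_flow_half_edge h : `|g h| = `|f (half_edge_edge h)|.
Proof. by rewrite normrM normrX normrN1 expr1n mul1r. Qed.

Lemma flow_half_edge_bounds h : h \in H -> 1 <= `|g h| <= r - 1.
Proof.
move=> _; rewrite norm_flow_half_edge; have [fP _] := flow_f.
by case: (fP (half_edge_edge h)) => // /eqP; rewrite (negPf (nz_f _)).
Qed.

Lemma card_half_edges_regular : #|H| = (2 * t + 1)%N.
Proof.
rewrite -(regG v) -card_half_edges_at; congr #|pred_of_set _|.
by apply/setP => h; rewrite !inE andbT.
Qed.

Lemma sum_flow_half_edges : \sum_(h in H) g h = 0.
Proof.
have [_ /(_ v) bd0] := flow_f; rewrite -[RHS]bd0.
by apply: eq_bigl => h; rewrite inE.
Qed.

Lemma regular_flow_bound : t%:R + 1 <= t%:R * (r - 1).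
Proof.
exact: odd_balanced_bound card_half_edges_regular flow_half_edge_bounds
  sum_flow_half_edges.
Qed.

Lemma degree_in_heavy : (1 <= t)%N -> (2 * t%:R - 1) * (r - 1) < 2 * t%:R + 1 ->
  degree_in [set e | 2 * t%:R <= (2 * t%:R - 1) * `|f e|] v = t.
Proof.
move=> t_ge1 r_lt; rewrite -card_half_edges_at.
rewrite -[RHS](card_heavy card_half_edges_regular flow_half_edge_bounds
  sum_flow_half_edges t_ge1 r_lt).
by congr #|pred_of_set _|; apply/setP => h; rewrite !inE norm_flow_half_edge.
Qed.

End AtVertex.
End HalfEdgeSums.

(** * Flow spectra of odd regular graphs *)

Section Spectra.
Variables (R : realType) (G : multigraph) (t : nat).
Hypothesis regG : regular G (2 * t + 1).

Lemma nz_flow_bound (sigma : signature G) (r : R) :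
  admits_nz_flow sigma r -> t%:R + 1 <= t%:R * (r - 1).
Proof.
case=> _ [tau [f [_ flow_f nz_f]]].
have /card_gt0P[v _] := card_vertex_gt0 G.
exact: regular_flow_bound regG flow_f nz_f v.
Qed.

(** All half-edges of the factor leave their vertex and all others enter it, so
    both half-edges of an edge have equal signs and every edge is negative. The
    boundary is t(1 + 1/t) - (t+1) = 0. *)
Lemma factor_nz_flow : (1 <= t)%N -> has_factor G t ->
  admits_nz_flow (fun _ : edge G => true) (2 + 1 / t%:R : R).
Proof.
move=> t_ge1 [F factF].
have t_gt0 : 0 < t%:R :> R by rewrite ltr0n.
have invt_ge0 : 0 <= 1 / t%:R :> R by rewrite divr_ge0.
split; first by lra.
exists (fun h => half_edge_edge h \notin F).
exists (fun e => if e \in F then 1 + 1 / t%:R else 1).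
split.
- move=> h h' -> _; rewrite -exprD addnn -signr_odd odd_double.
  by rewrite expr0 expr1 opprK.
- split=> [e|v].
    by right; case: ifP => _; rewrite ?normr1 ?ger0_norm; lra.
  rewrite /boundary (bigID (fun h => half_edge_edge h \in F)) /=.
  rewrite (eq_bigr (fun=> 1 + 1 / t%:R)); last first.
    by move=> h /andP[_ ->]; rewrite expr0 mul1r.
  rewrite [X in _ + X](eq_bigr (fun=> -1)); last first.
    by move=> h /andP[_ hNF]; rewrite hNF (negPf hNF) expr1 mulr1.
  rewrite [X in _ + X](eq_bigl (fun h =>
    (half_edge_vertex h == v) && (half_edge_edge h \in ~: F))); last first.
    by move=> h; rewrite inE.
  rewrite !sum_half_edges_const factF.
  have -> : degree_in (~: F) v = t.+1.
    by have := degree_in_setC F v; rewrite factF regG; lia.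
  by rewrite -natr1; field; rewrite gt_eqF.
- by move=> e; case: ifP => _; rewrite ?oner_neq0 // gt_eqF //; lra.
Qed.

Lemma factor_flow_spectrum : (1 <= t)%N -> has_factor G t ->
  flow_spectrum R G (2 + 1 / t%:R)%:E.
Proof.
move=> t_ge1 factG; have nzf := factor_nz_flow t_ge1 factG.
exists (fun=> true); first by exists (2 + 1 / t%:R).
apply/eqP; rewrite eq_le; apply/andP; split.
  by apply: ereal_inf_lbound; exists (2 + 1 / t%:R).
apply/le_ereal_inf_tmp => _ [r /= nzr <-].
rewrite lee_fin; have := nz_flow_bound nzr.
have t_gt0 : 0 < t%:R :> R by rewrite ltr0n.
have : t%:R * (1 / t%:R) = 1 :> R by rewrite mulrC divfK // gt_eqF.
nra.
Qed.

(** Some flow has r - 1 < (2t+1)/(2t-1), that is r < 2 + 2/(2t-1), since this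
    bound exceeds the infimum 2 + 1/t; its heavy edges form the factor. *)
Lemma flow_spectrum_factor : (1 <= t)%N ->
  flow_spectrum R G (2 + 1 / t%:R)%:E -> has_factor G t.
Proof.
move=> t_ge1 [sigma _ inf_eq].
have T_ge1 : 1 <= t%:R :> R by rewrite ler1n.
have d_gt0 : 0 < 2 * t%:R - 1 :> R by lra.
have : (circular_flow_number R sigma < (2 + 2 / (2 * t%:R - 1))%:E)%E.
  rewrite inf_eq lte_fin ltrD2l ltr_pdivrMr; last by lra.
  by rewrite mulrAC ltr_pdivlMr //; lra.
case/ereal_inf_lt => _ [r [_ [tau [f [_ flow_f nz_f]]]] <-].
rewrite lte_fin => r_lt; exists [set e | 2 * t%:R <= (2 * t%:R - 1) * `|f e|].
move=> v; apply: (degree_in_heavy regG flow_f nz_f v t_ge1).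
have : 2 / (2 * t%:R - 1) * (2 * t%:R - 1) = 2 :> R by rewrite divfK // gt_eqF.
nra.
Qed.

(** The flow is 1 on D and 2 elsewhere; signs that cancel are chosen at each
    vertex separately. *)
Lemma even_subgraph_int_nz_flow (D : {set edge G}) :
  (forall v, (0 < degree_in D v)%N) -> (forall v, ~~ odd (degree_in D v)) ->
  exists sigma : signature G, admits_int_nz_flow R sigma 3.
Proof.
move=> D_gt0 D_even.
pose H (v : vertex G) := [set h : half_edge G | half_edge_vertex h == v].
pose B := [set h : half_edge G | half_edge_edge h \in D].
have cardHB v : #|H v :&: B| = degree_in D v.
  rewrite -card_half_edges_at; congr #|pred_of_set _|.
  by apply/setP => h; rewrite !inE.
have cardHD v : #|H v :\: B| = degree_in (~: D) v.
  rewrite -card_half_edges_at; congr #|pred_of_set _|.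
  by apply/setP => h; rewrite !inE andbC.
have /choice[s sum0] : forall v, exists s : half_edge G -> bool,
    \sum_(h in H v) (-1) ^+ s h * (if h \in B then 1 else 2) = 0 :> R.
  move=> v; apply: ones_and_twos_cancel; rewrite ?cardHB // cardHD.
  have := D_even v; have := degree_in_setC D v; rewrite regG; lia.
pose tau (h : half_edge G) := s (half_edge_vertex h) h.
exists (signature_of tau); split=> //.
exists tau, (fun e => if e \in D then 1 else 2); split.
- exact: signature_ofP.
- split=> [e|v]; first by right; case: ifP => _; rewrite ger0_norm; lra.
  rewrite -[RHS](sum0 v); apply: eq_big => h; first by rewrite inE.
  by move=> /eqP hv; rewrite /tau hv inE.
- by move=> e; case: ifP => _; rewrite ?oner_neq0 ?pnatr_eq0.
- by move=> e; case: ifP => _; rewrite ?rpred1 ?rpred_nat.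
Qed.

Lemma no_int_nz_2flow (sigma : signature G) : ~ admits_int_nz_flow R sigma 2.
Proof.
case=> _ [tau [f [ori flow_f nz_f _]]].
have : admits_nz_flow sigma (2 : R) by split=> //; exists tau, f.
by move/nz_flow_bound; lra.
Qed.

Lemma even_subgraph_int_spectrum (D : {set edge G}) :
  (forall v, (0 < degree_in D v)%N) -> (forall v, ~~ odd (degree_in D v)) ->
  integer_flow_spectrum R G (Some 3%N).
Proof.
move=> D_gt0 D_even.
have [sigma int3] := even_subgraph_int_nz_flow D_gt0 D_even; exists sigma.
  have [_ [tau [f [ori flow_f nz_f _]]]] := int3.
  by exists 3; split; [lra | exists tau, f].
rewrite /integer_flow_number; case: pselect => [ex|]; last first.
  by case; exists 3%N; apply/asboolP.
congr Some; case: ex_minnP => k /asboolP intk /(_ 3%N) k_min.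
have {k_min} : (k <= 3)%N by apply: k_min; apply/asboolP.
have [k_ge2 _] := intk.
have : k != 2%N by apply/eqP => k2; apply: (@no_int_nz_2flow sigma); rewrite -k2.
lia.
Qed.

Lemma one_factor_int_spectrum : (1 <= t)%N -> has_factor G 1 ->
  integer_flow_spectrum R G (Some 3%N).
Proof.
move=> t_ge1 [M factM].
have degC v : degree_in (~: M) v = (2 * t)%N.
  by have := degree_in_setC M v; rewrite factM regG; lia.
by apply: (@even_subgraph_int_spectrum (~: M)) => v; rewrite degC; lia.
Qed.

End Spectra.

(** * Multigraphs given by edge multiplicities *)

Section Thickening.
Variables (V L : finType) (src tgt : L -> V) (mult : L -> nat).
Hypothesis src_neq_tgt : forall l, src l != tgt l.
Hypothesis V_gt0 : (0 < #|V|)%N.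

Definition thick_ends (e : {l : L & 'I_(mult l)}) : {set V} :=
  [set src (tag e); tgt (tag e)].

Lemma card_thick_ends e : #|thick_ends e| = 2%N.
Proof. by rewrite cards2 src_neq_tgt. Qed.

Definition thickening := Multigraph card_thick_ends V_gt0.

Lemma degree_in_thickening (F : {set edge thickening}) (v : V) :
  @degree_in thickening F v =
    (\sum_(l | (src l == v) || (tgt l == v)) #|[set e in F | tag e == l]|)%N.
Proof.
rewrite /degree_in -sum1_card (partition_big (fun e : edge thickening => tag e)
  (fun l => (src l == v) || (tgt l == v))) /= => [|e]; last first.
  by rewrite !inE ![v == _]eq_sym => /andP[].
apply: eq_bigr => l lv; rewrite -sum1_card; apply: eq_bigl => e.
rewrite !inE ![v == _]eq_sym -andbA; congr (_ && _).
by have [->|] := eqVneq (tag e) l; rewrite ?andbF // andbT.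
Qed.

Definition first_parallels (q : L -> nat) : {set edge thickening} :=
  [set e : edge thickening | (tagged e < q (tag e))%N].

Lemma card_first_parallels q l : (q l <= mult l)%N ->
  #|[set e in first_parallels q | tag e == l]| = q l.
Proof.
move=> q_le; rewrite -[RHS]card_ord.
pose F (i : 'I_(q l)) : edge thickening :=
  Tagged (fun l => 'I_(mult l)) (widen_ord q_le i).
rewrite -(card_imset (f := F)); last first.
  move=> i j /eqP; rewrite -tag_eqE /tag_eq eqxx /= tagged_asE.
  by move=> /eqP/(congr1 val) ij; apply: val_inj.
congr #|pred_of_set _|; apply/setP => e; rewrite !inE.
apply/andP/imsetP => [|[j _ ->]]; last by rewrite /= ltn_ord.
case: e => k i /= [i_lt /eqP kl].
subst k; exists (Ordinal i_lt) => //.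
by congr Tagged; apply: val_inj.
Qed.

Lemma first_parallels_all : first_parallels mult = [set: edge thickening].
Proof. by apply/setP => e; rewrite !inE ltn_ord. Qed.

End Thickening.

(** * A regular graph without 1-factor *)

Section Windmill.
Variable t : nat.
Hypothesis t_gt1 : (1 < t)%N.

(** The centre is [None]; [Some (i, j)] is corner j of triangle i. *)
Definition windmill_vertex : finType := option ('I_3 * 'I_3).

(** Line [(i, 0)] is the spoke from the centre to corner 0 of triangle i, lines
    [(i, 1)] and [(i, 2)] join corner 0 to corners 1 and 2, and line [(i, 3)] is
    the side opposite to corner 0. *)
Definition windmill_line : finType := ('I_3 * 'I_4)%type.

Definition windmill_src (l : windmill_line) : windmill_vertex :=
  let: (i, j) := l in
  match val j with
  | 0 => None
  | 3 => Some (i, inord 1)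
  | _ => Some (i, ord0)
  end.

Definition windmill_tgt (l : windmill_line) : windmill_vertex :=
  let: (i, j) := l in
  match val j with
  | 0 => Some (i, ord0)
  | 1 => Some (i, inord 1)
  | _ => Some (i, inord 2)
  end.

(** If the two sides at corner 0 have multiplicity n, regularity of the corners
    forces 2t+1-n on the opposite side and 2t+1-2n, an odd number, on the spoke.
    Taking n = 1, t, t gives the centre degree (2t-1) + 1 + 1 and one spoke that
    is at least triple when t > 1. *)
Definition windmill_mult (l : windmill_line) : nat :=
  let: (i, j) := l in
  let n := if val i == 0%N then 1%N else t in
  match val j with
  | 0 => 2 * t + 1 - 2 * n
  | 3 => 2 * t + 1 - n
  | _ => n
  end.

Lemma windmill_src_neq_tgt l : windmill_src l != windmill_tgt l.
Proof.
case: l => i [[|[|[|[|//]]]] ltj] //=; apply/eqP => -[] /(congr1 val);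
  by rewrite /= !inordK.
Qed.

Lemma windmill_vertex_gt0 : (0 < #|windmill_vertex|)%N.
Proof. by apply/card_gt0P; exists None. Qed.

Definition windmill : multigraph :=
  thickening windmill_mult windmill_src_neq_tgt windmill_vertex_gt0.

Section Degrees.
Variable F : {set edge windmill}.
Let m (l : windmill_line) := #|[set e in F | tag e == l]|.

Lemma degree_in_windmill_centre :
  @degree_in windmill F None = (\sum_i m (i, ord0))%N.
Proof.
rewrite degree_in_thickening.
rewrite (reindex_onto (fun i : 'I_3 => (i, ord0 : 'I_4)) fst) /= => [|[i j]].
  by apply: eq_bigl => i; rewrite /= eqxx.
by case: j => [[|[|[|[|//]]]] ltj] //= _; congr (_, _); apply: val_inj.
Qed.

Lemma degree_in_windmill_blade i (j : 'I_3) :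
  @degree_in windmill F (Some (i, j)) =
    match val j with
    | 0 => m (i, ord0) + m (i, inord 1) + m (i, inord 2)
    | 1 => m (i, inord 1) + m (i, inord 3)
    | _ => m (i, inord 2) + m (i, inord 3)
    end%N.
Proof.
have o1 : inord 1 = lift ord0 ord0 :> 'I_4 by apply/val_inj; rewrite /= inordK.
have o2 : inord 2 = lift ord0 (lift ord0 ord0) :> 'I_4.
  by apply/val_inj; rewrite /= inordK.
have o3 : inord 3 = lift ord0 (lift ord0 (lift ord0 ord0)) :> 'I_4.
  by apply/val_inj; rewrite /= inordK.
rewrite degree_in_thickening.
pose at_j (k : 'I_4) :=
  (windmill_src (i, k) == Some (i, j)) || (windmill_tgt (i, k) == Some (i, j)).
rewrite (eq_bigl (fun l => (l.1 == i) && at_j l.2)); last first.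
  move=> [i' [[|[|[|[|//]]]] ltk]]; rewrite /at_j /=;
    by rewrite !(inj_eq Some_inj) !xpair_eqE eqxx -?andb_orr.
rewrite -(pair_big (pred1 i) at_j (fun i k => m (i, k))) /= big_pred1_eq.
rewrite /at_j big_mkcond !big_ord_recl big_ord0 /=.
rewrite !(inj_eq Some_inj) !xpair_eqE eqxx /=.
rewrite o1 o2 o3 -!val_eqE /= !inordK //.
by case: j {at_j} => [[|[|[|//]]] ltj] /=; rewrite !(addn0, add0n) ?addnA.
Qed.

End Degrees.

Lemma windmill_regular : regular windmill (2 * t + 1).
Proof.
have card_lines l :
    #|[set e in [set: edge windmill] | tag e == l]| = windmill_mult l.
  rewrite -(first_parallels_all _ windmill_src_neq_tgt windmill_vertex_gt0).
  by rewrite card_first_parallels.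
case=> [[i j]|]; last first.
  rewrite degree_in_windmill_centre; under eq_bigr do rewrite card_lines.
  by rewrite !big_ord_recl big_ord0 /=; lia.
rewrite degree_in_windmill_blade !card_lines /= !inordK //.
by case: ifP => _; case: j => [[|[|[|//]]] ltj] /=; lia.
Qed.

(** A triangle has three corners, so a 1-factor uses an odd number of its spoke
    edges, hence at least one; the centre would have degree at least 3. *)
Lemma windmill_no_one_factor : ~ has_factor windmill 1.
Proof.
case=> M factM.
pose m l := #|[set e in M | tag e == l]|.
have spoke_gt0 i : (0 < m (i, ord0))%N.
  have := factM (Some (i, ord0)); have := factM (Some (i, inord 1)).
  have := factM (Some (i, inord 2)).
  rewrite !degree_in_windmill_blade /= !inordK // -!/(m _); lia.
have := factM None.
rewrite degree_in_windmill_centre !big_ord_recl big_ord0 -!/(m _).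
have := spoke_gt0 ord0; have := spoke_gt0 (lift ord0 ord0); lia.
Qed.

(** Multiplicities of the subgraph with positive even degrees: the three simple
    triangles, and a double edge from the centre to the first one. *)
Definition windmill_light (l : windmill_line) : nat :=
  let: (i, j) := l in
  if val j == 0%N then if val i == 0%N then 2 else 0 else 1.

Lemma windmill_int_spectrum (R : realType) :
  integer_flow_spectrum R windmill (Some 3%N).
Proof.
pose D : {set edge windmill} :=
  first_parallels _ windmill_src_neq_tgt windmill_vertex_gt0 windmill_light.
have card_lines l : #|[set e in D | tag e == l]| = windmill_light l.
  apply: card_first_parallels; case: l => i [[|[|[|[|//]]]] ltj] /=;
    by case: ifP => _; lia.
have degD v : exists2 d, @degree_in windmill D v = d.*2 & (0 < d)%N.
  case: v => [[i j]|]; last first.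
    exists 1%N => //; rewrite degree_in_windmill_centre.
    by under eq_bigr do rewrite card_lines; rewrite !big_ord_recl big_ord0.
  exists (if (val i == 0%N) && (val j == 0%N) then 2 else 1)%N; last by case: ifP.
  rewrite degree_in_windmill_blade !card_lines /= !inordK //.
  by case: eqP => _; case: j => [[|[|[|//]]] ltj].
apply: (even_subgraph_int_spectrum R windmill_regular (D := D)) => v.
  by have [d ->] := degD v; rewrite double_gt0.
by have [d ->] := degD v; rewrite odd_double.
Qed.
End Windmill.

Local Open Scope classical_set_scope.

Theorem theorem3p4 (R : realType) (t : nat) (ht : (1 <= t)%N) :
  [/\ forall G : multigraph, regular G (2 * t + 1) ->
        (has_factor G t <-> flow_spectrum R G (2 + 1 / t%:R)%:E),
      forall G : multigraph, regular G (2 * t + 1) -> has_factor G 1 ->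
        integer_flow_spectrum R G (Some 3%N)
    & (1 < t)%N -> exists G : multigraph,
        [/\ regular G (2 * t + 1), ~ has_factor G 1
          & integer_flow_spectrum R G (Some 3%N)]].
Proof.
split=> [G regG|G regG|t_gt1].
- by split; [apply: factor_flow_spectrum | apply: flow_spectrum_factor].
- exact: one_factor_int_spectrum ht.
- exists (windmill t); split.
  + exact: windmill_regular.
  + exact: windmill_no_one_factor.
  + exact: windmill_int_spectrum.
Qed.
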